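(* For one VIPA of capacity $\mathrm{Cap}$ operating in elevator mode on a line $L=(v_0,\dots,v_n)$ with origin $v_0$, the online algorithm MAIN is, with respect to the objective of minimizing the total tour length, (i) $2\cdot\mathrm{Cap}$-competitive during the lunch scenario; (ii) $\mathrm{Cap}$-competitive during the morning scenario, resp. the evening scenario.
   Context: A request is $r_j=(t_j,x_j,y_j,z_j)$: released at time $t_j$ (and only then known to the online algorithm), with origin $x_j$, destination $y_j$ and $z_j$ passengers. The VIPA has capacity $\mathrm{Cap}$ and unit speed. A feasible transportation schedule is a tour starting and ending at $v_0$ carrying every passenger from origin to destination, never serving a request before its release date; its total tour length is its length. In elevator mode the VIPA moves along the line, may change direction at any station and may wait. Stations are ordered $v_0<v_1<\dots<v_n$. An online algorithm ALG is $c$-competitive if $ALG(\sigma)\le c\cdot OPT(\sigma)$ for every request sequence $\sigma$, where $OPT(\sigma)$ is the optimal offline total tour length. Scenarios: in the lunch scenario $v_0$ is the restaurant and every request has $x_j=v_0$ or $y_j=v_0$; in the morning scenario $v_0$ is a parking and every request has $x_j=v_0$; in the evening scenario $v_0$ is a parking and every request has $y_j=v_0$. Algorithm MAIN (''Move Away If Necessary''): the server starts at $s:=v_0$; let $\sigma'$ be the set of released but not yet served requests. While $\sigma'\ne\emptyset$: let $\sigma'_{up}$ be the requests in $\sigma'$ with $s\le x_j\le y_j$; if $\sigma'_{up}\neq\emptyset$, serve all requests (or up to $\mathrm{Cap}$ passengers) of $\sigma'_{up}$, moving away from $v_0$ to the furthest destination among them; otherwise let $\sigma'_{down}$ be the requests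 in $\sigma'$ with $x_j>y_j$ and serve all of them (or up to $\mathrm{Cap}$ passengers) while moving towards the origin; then update $s$ and $\sigma'$. *)

(* Defs.v *)
(* classical_sets is imported first, so that set0, [set x | P] and \subset
   below denote the finite-set notions of finset. *)
From mathcomp Require Import classical_sets reals.
From mathcomp Require Import all_boot all_order all_algebra.

Set Implicit Arguments.
Unset Strict Implicit.
Unset Printing Implicit Defensive.

Import Order.TTheory GRing.Theory Num.Theory.
Local Open Scope ring_scope.

(* The stations v_0 < ... < v_n of a line are the ordinals i : 'I_n.+1 (the
   origin v_0 is ord0); loc i is the coordinate of v_i on the line. *)
Definition is_line (R : realType) (n : nat) (loc : 'I_n.+1 -> R) : Prop :=
  forall i j : 'I_n.+1, (i < j)%N -> loc i < loc j.

Definition dist (R : realType) (n : nat) (loc : 'I_n.+1 -> R)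
  (u v : 'I_n.+1) : R := `|loc u - loc v|.

Record request (R : realType) (n : nat) := Request {
  release : R;
  origin : 'I_n.+1;
  destination : 'I_n.+1;
  npass : nat }.

Definition request_sequence (R : realType) (n : nat)
    (sigma : seq (request R n)) : Prop :=
  forall j : 'I_(size sigma),
    let r := tnth (in_tuple sigma) j in 0 <= release r /\ (0 < npass r)%N.

Definition lunch (R : realType) (n : nat) (sigma : seq (request R n)) : Prop :=
  forall j : 'I_(size sigma),
    let r := tnth (in_tuple sigma) j in
    origin r = ord0 \/ destination r = ord0.

Definition morning (R : realType) (n : nat) (sigma : seq (request R n)) : Prop :=
  forall j : 'I_(size sigma), origin (tnth (in_tuple sigma) j) = ord0.

Definition evening (R : realType) (n : nat) (sigma : seq (request R n)) : Prop :=
  forall j : 'I_(size sigma), destination (tnth (in_tuple sigma) j) = ord0.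

(* The individual passengers: a pair (j, k) is the k-th passenger of r_j.  The
   passengers of one request need not travel together (in particular npass may
   exceed the capacity). *)
Definition passenger (R : realType) (n : nat)
    (sigma : seq (request R n)) : finType :=
  {j : 'I_(size sigma) & 'I_(npass (tnth (in_tuple sigma) j))}.

Definition preq (R : realType) (n : nat) (sigma : seq (request R n))
  (p : passenger sigma) : request R n := tnth (in_tuple sigma) (tag p).

Definition prel (R : realType) (n : nat) (sigma : seq (request R n))
  (p : passenger sigma) : R := release (preq p).

Definition porg (R : realType) (n : nat) (sigma : seq (request R n))
  (p : passenger sigma) : 'I_n.+1 := origin (preq p).

Definition pdst (R : realType) (n : nat) (sigma : seq (request R n))
  (p : passenger sigma) : 'I_n.+1 := destination (preq p).

(* A stop of the vehicle at a station, at a given time, with the passengers who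
   board and those who alight. *)
Record stop (R : realType) (n : nat) (sigma : seq (request R n)) := Stop {
  station : 'I_n.+1;
  time : R;
  boarding : {set passenger sigma};
  alighting : {set passenger sigma} }.

(* A schedule is the list of the successive stops of the vehicle, after its
   departure from v_0 at time 0, which is the following stop. *)
Definition depot (R : realType) (n : nat) (sigma : seq (request R n)) :
  stop sigma := Stop ord0 0 set0 set0.

(* A vehicle of unit speed goes from stop a to stop b; time left over is spent
   waiting. *)
Definition leg (R : realType) (n : nat) (loc : 'I_n.+1 -> R)
    (sigma : seq (request R n)) (a b : stop sigma) : bool :=
  time a + dist loc (station a) (station b) <= time b.

Definition on_board (R : realType) (n : nat) (sigma : seq (request R n))
    (S : seq (stop sigma)) : {set passenger sigma} :=
  [set p | has (fun a : stop sigma => p \in boarding a) S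
           && ~~ has (fun a : stop sigma => p \in alighting a) S].

(* p is carried from its origin, not before its release date, to its
   destination; boarding at stop i and alighting at stop j, and nowhere else. *)
Definition transported (R : realType) (n : nat) (sigma : seq (request R n))
    (S : seq (stop sigma)) (p : passenger sigma) : Prop :=
  exists i j : nat,
    [/\ (i <= j < size S)%N,
        forall k, (k < size S)%N ->
          (p \in boarding (nth (depot sigma) S k)) = (k == i),
        forall k, (k < size S)%N ->
          (p \in alighting (nth (depot sigma) S k)) = (k == j),
        station (nth (depot sigma) S i) = porg p
          /\ prel p <= time (nth (depot sigma) S i) &
        station (nth (depot sigma) S j) = pdst p].

Definition feasible (R : realType) (n : nat) (loc : 'I_n.+1 -> R) (Cap : nat)
    (sigma : seq (request R n)) (S : seq (stop sigma)) : Prop :=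
  [/\ path (leg loc (sigma := sigma)) (depot sigma) S,
      station (last (depot sigma) S) = ord0,
      forall p : passenger sigma, transported S p &
      forall k : nat, (#|on_board (take k S)| <= Cap)%N].

Fixpoint route_length (R : realType) (n : nat) (loc : 'I_n.+1 -> R)
    (u : 'I_n.+1) (w : seq 'I_n.+1) : R :=
  if w is v :: w' then dist loc u v + route_length loc v w' else 0.

Definition tour_length (R : realType) (n : nat) (loc : 'I_n.+1 -> R)
    (sigma : seq (request R n)) (S : seq (stop sigma)) : R :=
  route_length loc ord0 [seq station a | a <- S].

Definition OPT (R : realType) (n : nat) (loc : 'I_n.+1 -> R) (Cap : nat)
    (sigma : seq (request R n)) : R :=
  inf [set l : R | exists S : seq (stop sigma),
                     feasible loc Cap S /\ l = tour_length loc S]%classic.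

(* An algorithm is given by the schedules it may produce on each request
   sequence: a description such as that of MAIN leaves open which passengers
   are taken when they do not all fit, and the guarantee is to hold whatever
   the choice.  An algorithm has to produce a schedule, and a feasible one. *)
Definition algorithm (R : realType) (n : nat) : Type :=
  forall sigma : seq (request R n), seq (stop sigma) -> Prop.

Definition competitive (R : realType) (n : nat) (loc : 'I_n.+1 -> R)
    (Cap : nat) (scenario : seq (request R n) -> Prop)
    (ALG : algorithm R n) (c : R) : Prop :=
  forall sigma : seq (request R n), request_sequence sigma -> scenario sigma ->
    (exists S : seq (stop sigma), ALG sigma S)
    /\ forall S : seq (stop sigma), ALG sigma S ->
         feasible loc Cap S /\ tour_length loc S <= c * OPT loc Cap sigma.

(* In the algorithm MAIN, t is the current time, s the current position of the
   server, D the set of the passengers served so far. *)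

Definition waiting (R : realType) (n : nat) (sigma : seq (request R n))
    (t : R) (D : {set passenger sigma}) : {set passenger sigma} :=
  [set p | (prel p <= t) && (p \notin D)].

Definition waiting_up (R : realType) (n : nat) (sigma : seq (request R n))
    (t : R) (s : 'I_n.+1) (D : {set passenger sigma}) :
    {set passenger sigma} :=
  [set p in waiting t D | (s <= porg p <= pdst p)%N].

Definition waiting_down (R : realType) (n : nat) (sigma : seq (request R n))
    (t : R) (D : {set passenger sigma}) : {set passenger sigma} :=
  [set p in waiting t D | (pdst p < porg p)%N].

(* A consists of all the passengers of W or, when they exceed the capacity, of
   at least one and at most Cap of them. *)
Definition selection (Cap : nat) (T : finType) (W A : {set T}) : Prop :=
  [/\ A \subset W, (#|A| <= Cap)%N, (#|W| <= Cap)%N -> A = W &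
      W != set0 -> A != set0].

(* The vehicle starts from station u at time t and visits without waiting the
   monotone list of stations w, transporting the passengers of A. *)
Definition sweep (R : realType) (n : nat) (loc : 'I_n.+1 -> R)
    (sigma : seq (request R n)) (A : {set passenger sigma})
    (t : R) (u : 'I_n.+1) (w : seq 'I_n.+1) : seq (stop sigma) :=
  [seq Stop v (t + dist loc u v)
         [set p in A | porg p == v] [set p in A | pdst p == v] | v <- w].

Definition stations_up (n : nat) (u v : 'I_n.+1) : seq 'I_n.+1 :=
  [seq i : 'I_n.+1 <- enum 'I_n.+1 | (u <= i <= v)%N].

Definition stations_down (n : nat) (u : 'I_n.+1) : seq 'I_n.+1 :=
  rev [seq i : 'I_n.+1 <- enum 'I_n.+1 | (i <= u)%N].

(* MAIN_state t s D S: the server may be at station s at time t, about to take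
   its next decision, having served D by means of the stops S.
   - If no request is waiting, the server stays until the next release.
   - Up move: it goes from s to the furthest destination f of the passengers
     taken.
   - Down move: some passengers taken may start beyond s, so it first goes to
     the furthest of s and of their origins, then sweeps down to v_0 (also when
     nobody goes down, the waiting requests then all starting below s). *)
Inductive MAIN_state (R : realType) (n : nat) (loc : 'I_n.+1 -> R) (Cap : nat)
    (sigma : seq (request R n)) :
    R -> 'I_n.+1 -> {set passenger sigma} -> seq (stop sigma) -> Prop :=
| MAIN_start : MAIN_state loc Cap 0 ord0 set0 [::]
| MAIN_wait (t : R) (s : 'I_n.+1) (D : {set passenger sigma})
    (S : seq (stop sigma)) (p : passenger sigma) :
    MAIN_state loc Cap t s D S ->
    waiting t D = set0 ->
    p \notin D ->
    (forall q : passenger sigma, q \notin D -> prel p <= prel q) ->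
    MAIN_state loc Cap (prel p) s D S
| MAIN_up (t : R) (s : 'I_n.+1) (D : {set passenger sigma})
    (S : seq (stop sigma)) (A : {set passenger sigma}) (f : 'I_n.+1) :
    MAIN_state loc Cap t s D S ->
    waiting_up t s D != set0 ->
    selection Cap (waiting_up t s D) A ->
    f = (\max_(p in A) pdst p)%N :> nat ->
    MAIN_state loc Cap (t + dist loc s f) f (D :|: A)
      (S ++ sweep loc A t s (stations_up s f))
| MAIN_down (t : R) (s : 'I_n.+1) (D : {set passenger sigma})
    (S : seq (stop sigma)) (A : {set passenger sigma}) (m : 'I_n.+1) :
    MAIN_state loc Cap t s D S ->
    waiting t D != set0 ->
    waiting_up t s D = set0 ->
    selection Cap (waiting_down t D) A ->
    m = maxn s (\max_(p in A) porg p)%N :> nat ->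
    MAIN_state loc Cap (t + dist loc s m + dist loc m ord0) ord0 (D :|: A)
      (S ++ sweep loc A (t + dist loc s m) m (stations_down m)).

(* Once everybody has been served, the server returns to v_0. *)
Definition MAIN (R : realType) (n : nat) (loc : 'I_n.+1 -> R) (Cap : nat) :
    algorithm R n :=
  fun (sigma : seq (request R n)) (S : seq (stop sigma)) =>
    exists (t : R) (s : 'I_n.+1) (S' : seq (stop sigma)),
      MAIN_state loc Cap t s [set: passenger sigma] S'
      /\ S = rcons S' (Stop ord0 (t + dist loc s ord0) set0 set0).

(* Main.v *)
(* Let d(p) be the distance from the origin to the destination of a passenger
   p.  In the lunch scenario every excursion of MAIN away from v_0 has its
   furthest point at an end of the ride of some passenger served on it, whose
   other end is v_0: charging the excursion to that passenger shows that MAIN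
   travels at most 2 * sum_p d(p).
   Conversely, in a feasible schedule of length L, which is a closed tour, the
   vehicle travels L / 2 in each direction, with at most Cap passengers on
   board: hence the d(p) of the passengers going up add up to at most
   Cap * L / 2, and so do those of the passengers going down.  In the morning
   and evening scenarios everybody goes in the same direction, which saves the
   factor 2. *)
Require Import Defs.
From mathcomp Require Import classical_sets reals.
From mathcomp Require Import all_boot all_order all_algebra.
From mathcomp Require Import zify ring lra.
Import Order.TTheory GRing.Theory Num.Theory.
Local Open Scope ring_scope.

(** * Distances and directions of travel on the line *)

Lemma dist_ge0 {R : realType} {n : nat} (loc : 'I_n.+1 -> R) u v :
  0 <= dist loc u v.
Proof. exact: normr_ge0. Qed.

Lemma distxx {R : realType} {n : nat} (loc : 'I_n.+1 -> R) u :
  dist loc u u = 0.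
Proof. by rewrite /dist subrr normr0. Qed.

Lemma dist_sym {R : realType} {n : nat} (loc : 'I_n.+1 -> R) u v :
  dist loc u v = dist loc v u.
Proof. exact: distrC. Qed.

Lemma dist_triangle {R : realType} {n : nat} (loc : 'I_n.+1 -> R) v u w :
  dist loc u w <= dist loc u v + dist loc v w.
Proof. exact: ler_distD. Qed.

Lemma is_line_le {R : realType} {n : nat} {loc : 'I_n.+1 -> R} {u v : 'I_n.+1} :
  is_line loc -> (u <= v)%N -> loc u <= loc v.
Proof.
move=> hline; rewrite leq_eqVlt => /orP[/eqP/val_inj->//|/hline].
exact: ltW.
Qed.

Lemma dist_line {R : realType} {n : nat} {loc : 'I_n.+1 -> R} {u v : 'I_n.+1} :
  is_line loc -> (u <= v)%N -> dist loc u v = loc v - loc u.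
Proof.
by move=> hline uv; rewrite /dist ler0_norm ?opprB // subr_le0 is_line_le.
Qed.

(** Up and down travel are treated at once: a direction is a reflexive, antisymmetric and transitive
    relation along which distances add up, so that a monotone route is as short as the distance
    between its ends. *)
Definition direction {R : realType} {n : nat} (loc : 'I_n.+1 -> R)
    (e : rel 'I_n.+1) : Prop :=
  [/\ reflexive e, antisymmetric e, transitive e &
      forall u v w, e u v -> e v w ->
        dist loc u w = dist loc u v + dist loc v w].

Definition upward {n : nat} : rel 'I_n.+1 := fun u v => (u <= v)%N.
Definition downward {n : nat} : rel 'I_n.+1 := fun u v => (v <= u)%N.

Lemma direction_upward {R : realType} {n : nat} {loc : 'I_n.+1 -> R} :
  is_line loc -> direction loc upward.
Proof.
move=> hline; rewrite /upward; split.
- by move=> u.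
- by move=> u v uv; apply/val_inj/anti_leq.
- by move=> v u w; exact: leq_trans.
- move=> u v w uv vw; rewrite !(dist_line hline) ?(leq_trans uv) //; ring.
Qed.

Lemma direction_downward {R : realType} {n : nat} {loc : 'I_n.+1 -> R} :
  is_line loc -> direction loc downward.
Proof.
move=> /direction_upward[e1 e2 e3 e4]; split=> //.
- by move=> u v; rewrite andbC; exact: e2.
- by move=> v u w vu wv; exact: e3 wv vu.
- by move=> u v w vu wv; rewrite dist_sym (e4 _ _ _ wv vu) addrC !(dist_sym _ v).
Qed.


(** * Lengths of routes *)

Lemma route_length_cat {R : realType} {n : nat} (loc : 'I_n.+1 -> R) u w1 w2 :
  route_length loc u (w1 ++ w2) =
  route_length loc u w1 + route_length loc (last u w1) w2.
Proof. by elim: w1 u => [|v w1 IH] u /=; rewrite ?add0r // IH addrA. Qed.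

Lemma route_length_detour {R : realType} {n : nat} (loc : 'I_n.+1 -> R) s u w :
  route_length loc s w <= dist loc s u + route_length loc u w.
Proof.
case: w => [|v w] /=; first by rewrite addr0 dist_ge0.
by rewrite addrA lerD2r dist_triangle.
Qed.

Lemma route_length_monotone {R : realType} {n : nat} {loc : 'I_n.+1 -> R} {e}
    u w :
  direction loc e -> path e u w ->
  route_length loc u w = dist loc u (last u w).
Proof.
move=> [e1 _ e3 e4]; elim: w u => [|v w IH] u /=; first by rewrite distxx.
move=> /andP[uv vw]; rewrite (IH _ vw) -e4 //.
have := mem_last v w; rewrite inE => /orP[/eqP->//|].
by move: vw; rewrite (path_sortedE e3) => /andP[/allP h _] /h.
Qed.

Lemma route_length_sum {R : realType} {n : nat} (loc : 'I_n.+1 -> R) d u w :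
  route_length loc u w =
  \sum_(0 <= k < size w) dist loc (nth d (u :: w) k) (nth d (u :: w) k.+1).
Proof.
elim: w u => [|v w IH] u; first by rewrite big_geq.
by rewrite [LHS]/= IH [size _]/= big_nat_recl.
Qed.

(** * Sweeps and the passengers they carry *)

(** A sweep dates all its stops from [u]. The induction therefore keeps [u] fixed while [v] moves
    along the route; additivity of distances makes successive dates differ by exactly the length of
    the leg. *)
Lemma path_sweep {R : realType} {n : nat} {loc : 'I_n.+1 -> R} {e}
    {sigma : seq (request R n)} (A : {set passenger sigma}) t u v w
    (a : stop sigma) :
  direction loc e -> e u v -> path e v w ->
  time a + dist loc (station a) v <= t + dist loc u v ->
  path (leg loc (sigma := sigma)) a (sweep loc A t u w).
Proof.
move=> [e1 _ e3 e4]; elim: w v a => //= v' w IH v a uv /andP[vv' v'w] le_t.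
apply/andP; split; last first.
  by apply: IH v'w _; rewrite ?distxx ?addr0 //; exact: e3 uv vv'.
rewrite /leg /= (e4 _ _ _ uv vv').
have := dist_triangle loc v (station a) v'; lra.
Qed.

(** Since [transported] demands a single boarding and a single alighting, it survives concatenation
    only if the other piece of the schedule does not touch the passenger. *)
Definition absent {R : realType} {n : nat} {sigma : seq (request R n)}
    (p : passenger sigma) (S : seq (stop sigma)) : bool :=
  all (fun a => (p \notin boarding a) && (p \notin alighting a)) S.

Lemma absent_cat {R : realType} {n : nat} {sigma : seq (request R n)}
    (p : passenger sigma) S1 S2 :
  absent p (S1 ++ S2) = absent p S1 && absent p S2.
Proof. exact: all_cat. Qed.

Lemma absent_sweep {R : realType} {n : nat} (loc : 'I_n.+1 -> R)
    {sigma : seq (request R n)} (A : {set passenger sigma}) t u w p :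
  p \notin A -> absent p (sweep loc A t u w).
Proof.
move=> pA; rewrite /absent all_map; apply/allP => v _ /=.
by rewrite !inE (negbTE pA).
Qed.

(** No bound on [k] is required: past the end, [nth] returns the depot stop, where nobody boards or
    alights. *)
Lemma absent_nth {R : realType} {n : nat} {sigma : seq (request R n)}
    {p : passenger sigma} {S} k :
  absent p S ->
  (p \in boarding (nth (depot sigma) S k)) = false /\
  (p \in alighting (nth (depot sigma) S k)) = false.
Proof.
move=> /all_nthP h; have [kS|kS] := ltnP k (size S).
  by have /andP[/negbTE-> /negbTE->] := h (depot sigma) _ kS.
by rewrite nth_default // /depot /= !inE.
Qed.

Lemma transported_catl {R : realType} {n : nat} {sigma : seq (request R n)}
    (S1 S2 : seq (stop sigma)) p :
  transported S1 p -> absent p S2 -> transported (S1 ++ S2) p.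
Proof.
move=> [i [j [/andP[ij jS] hb ha [so st] sd]]] /absent_nth ab.
have iS := leq_ltn_trans ij jS.
exists i, j; rewrite !nth_cat size_cat ij jS iS ltn_addr //=; split=> // k _.
  rewrite nth_cat; case: ltnP => [/hb//|Sk].
  by have [-> _] := ab (k - size S1)%N; lia.
rewrite nth_cat; case: ltnP => [/ha//|Sk].
by have [_ ->] := ab (k - size S1)%N; lia.
Qed.

Lemma transported_catr {R : realType} {n : nat} {sigma : seq (request R n)}
    (S1 S2 : seq (stop sigma)) p :
  absent p S1 -> transported S2 p -> transported (S1 ++ S2) p.
Proof.
move=> /absent_nth ab [i [j [/andP[ij jS] hb ha [so st] sd]]].
exists (size S1 + i)%N, (size S1 + j)%N.
rewrite !nth_cat size_cat !ltnNge !leq_addr /= !addKn -ltnNge.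
rewrite leq_add2l ij ltn_add2l jS; split=> // k kS; rewrite nth_cat.
  case: ltnP => Sk; first by have [-> _] := ab k; lia.
  by rewrite hb; lia.
case: ltnP => Sk; first by have [_ ->] := ab k; lia.
by rewrite ha; lia.
Qed.

Lemma transported_sweep {R : realType} {n : nat} {loc : 'I_n.+1 -> R} {e}
    {sigma : seq (request R n)} (A : {set passenger sigma}) t u w p :
  direction loc e -> sorted e w -> uniq w ->
  p \in A -> porg p \in w -> pdst p \in w -> e (porg p) (pdst p) ->
  prel p <= t -> transported (sweep loc A t u w) p.
Proof.
move=> [e1 e2 e3 _] sw uw pA ow dw od pt.
have nthE k : (k < size w)%N -> nth (depot sigma) (sweep loc A t u w) k =
    let v := nth ord0 w k in Stop v (t + dist loc u v)
      [set p in A | porg p == v] [set p in A | pdst p == v].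
  by move=> kw; rewrite /sweep (nth_map ord0).
(* Since [w] has no repetition, each end of the ride is met at one stop only; since [w] is sorted,
   the origin is not met after the destination. *)
exists (index (porg p) w), (index (pdst p) w).
rewrite size_map !nthE ?index_mem // !nth_index //=; split=> //.
- rewrite dw andbT leqNgt; apply/negP => lt_do.
  have od' := sorted_ltn_index e3 sw _ _ dw ow lt_do.
  have odE : porg p = pdst p by apply: e2; rewrite od od'.
  by move: lt_do; rewrite odE ltnn.
- move=> k kw; rewrite nthE // !inE pA /= -[in LHS](nth_index ord0 ow).
  by rewrite nth_uniq ?index_mem // eq_sym.
- move=> k kw; rewrite nthE // !inE pA /= -[in LHS](nth_index ord0 dw).
  by rewrite nth_uniq ?index_mem // eq_sym.
- by split=> //; rewrite (le_trans pt) // lerDl dist_ge0.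
Qed.

(** * The invariant of [MAIN] and the feasibility of its schedules *)

(** The invariant kept between two decisions. The last stop may be earlier than [t], because the
    server may have waited since; passengers outside [D] are untouched, which allows a later sweep
    to carry them. *)
Definition serving_state {R : realType} {n : nat} (loc : 'I_n.+1 -> R)
    (Cap : nat) {sigma : seq (request R n)} (t : R) (s : 'I_n.+1)
    (D : {set passenger sigma}) (S : seq (stop sigma)) : Prop :=
  [/\ path (leg loc (sigma := sigma)) (depot sigma) S,
      station (last (depot sigma) S) = s /\ time (last (depot sigma) S) <= t,
      forall p, p \in D -> transported S p,
      forall p, p \notin D -> absent p S &
      forall k : nat, (#|on_board (take k S)| <= Cap)%N].

(** This covers an up move ([u] is [s]), a down move ([u] is the turning point) and the final return
    (nobody carried). Capacity holds during the sweep because everybody in [D] has already alighted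
    and nobody else boarded before, so only passengers of [A] can be on board. *)
Lemma serving_state_sweep {R : realType} {n : nat} {loc : 'I_n.+1 -> R} {e}
    {Cap : nat} {sigma : seq (request R n)} {t s D}
    {S : seq (stop sigma)} {A : {set passenger sigma}} {u f w} :
  direction loc e -> serving_state loc Cap t s D S ->
  path e u w -> uniq w -> w != [::] -> last u w = f ->
  [disjoint A & D] -> (#|A| <= Cap)%N ->
  (forall p, p \in A -> [/\ prel p <= t, e (porg p) (pdst p),
                           porg p \in w & pdst p \in w]) ->
  serving_state loc Cap (t + dist loc s u + dist loc u f) f (D :|: A)
    (S ++ sweep loc A (t + dist loc s u) u w).
Proof.
move=> dir [hS [hs ht] hD hnD hC] uw unw w0 lw AD AC hA.
have DA p : p \in D -> p \notin A by move=> pD; rewrite (disjointFl AD).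
have AnD p : p \in A -> p \notin D by move=> pA; rewrite (disjointFr AD).
split.
- rewrite cat_path hS /=; apply: (path_sweep A _ u u _ _ dir) => //.
    by case: dir => e1 *; exact: e1.
  by rewrite distxx addr0 hs lerD2r.
- rewrite last_cat; case: w w0 lw {uw unw hA} => // v w _ /=.
  by rewrite last_map /= => ->.
- move=> p; rewrite inE => /orP[pD|pA].
    by apply: transported_catl (hD p pD) _; rewrite absent_sweep ?DA.
  have [pt od ow dw] := hA p pA.
  apply: transported_catr; first exact/hnD/AnD.
  apply: (transported_sweep _ _ _ _ _ dir) => //; first exact: path_sorted uw.
  by rewrite (le_trans pt) // lerDl dist_ge0.
- move=> p; rewrite inE negb_or => /andP[/hnD pS pA].
  by rewrite absent_cat pS absent_sweep.
- move=> k; rewrite take_cat; case: ltnP => [_|Sk]; first exact: hC.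
  apply: leq_trans AC; apply/subset_leq_card/subsetP => p.
  rewrite inE !has_cat => /andP[+ /norP[hal _]].
  case/boolP: (p \in D) => [/hD[i [j [/andP[_ jS] _ ha _ _]]]|/hnD pS].
    case/negP: hal; apply/(has_nthP (depot sigma)); exists j => //.
    by rewrite ha.
  case/orP => [/(has_nthP (depot sigma))[i iS]|].
    by have [-> _] := absent_nth i pS.
  by rewrite -map_take has_map => /hasP[v _] /=; rewrite inE => /andP[].
Qed.

Lemma sorted_stations_up {n : nat} (u v : 'I_n.+1) :
  sorted upward (stations_up u v).
Proof.
apply: sorted_filter; first by move=> y x z; exact: leq_trans.
have := iota_sorted 0 n.+1; rewrite -val_enum_ord sorted_map.
by apply: sub_sorted.
Qed.

Lemma mem_stations_up {n : nat} (u v i : 'I_n.+1) :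
  (i \in stations_up u v) = (u <= i <= v)%N.
Proof. by rewrite mem_filter mem_enum andbT. Qed.

Lemma uniq_stations_up {n : nat} (u v : 'I_n.+1) : uniq (stations_up u v).
Proof. by rewrite filter_uniq // enum_uniq. Qed.

Lemma stations_downE {n : nat} (u : 'I_n.+1) :
  stations_down u = rev (stations_up ord0 u).
Proof. by []. Qed.

Lemma path_stations_up {n : nat} (u v : 'I_n.+1) :
  path upward u (stations_up u v).
Proof.
rewrite path_sortedE; last by move=> y x z; exact: leq_trans.
rewrite sorted_stations_up andbT; apply/allP => i.
by rewrite mem_stations_up => /andP[].
Qed.

Lemma path_stations_down {n : nat} (u : 'I_n.+1) :
  path downward u (stations_down u).
Proof.
rewrite path_sortedE; last by move=> y x z xy yz; exact: leq_trans yz xy.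
rewrite stations_downE rev_sorted sorted_stations_up andbT.
by apply/allP => i; rewrite mem_rev mem_stations_up.
Qed.

Lemma last_path {T : eqType} {e : rel T} {u f : T} {w : seq T} :
  antisymmetric e -> transitive e -> path e u w -> f \in w ->
  (forall v, v \in w -> e v f) -> last u w = f.
Proof.
move=> anti tr + fw; case/splitPr: fw => w1 w2.
rewrite cat_path /= last_cat => /and3P[_ _]; rewrite (path_sortedE tr) /=.
move=> /andP[/allP fw2 _] wf.
have := mem_last f w2; rewrite inE => /orP[/eqP//|lw2].
apply: anti; rewrite wf ?mem_cat ?inE ?lw2 ?orbT //=.
exact: fw2.
Qed.

Lemma last_stations_up {n : nat} (u v : 'I_n.+1) :
  (u <= v)%N -> last u (stations_up u v) = v.
Proof.
move=> uv; apply: (@last_path _ upward) (path_stations_up u v) _ _.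
- by move=> x y xy; apply/val_inj/anti_leq.
- by move=> y x z; exact: leq_trans.
- by rewrite mem_stations_up uv /=.
- by move=> i; rewrite mem_stations_up => /andP[].
Qed.

Lemma last_stations_down {n : nat} (u : 'I_n.+1) :
  last u (stations_down u) = ord0.
Proof.
apply: (@last_path _ downward) (path_stations_down u) _ _.
- by move=> x y; rewrite andbC => xy; apply/val_inj/anti_leq.
- by move=> y x z xy yz; exact: leq_trans yz xy.
- by rewrite stations_downE mem_rev mem_stations_up.
- by [].
Qed.

Lemma MAIN_serving_state {R : realType} {n : nat} {loc : 'I_n.+1 -> R}
    {Cap : nat} {sigma : seq (request R n)} {t s D} {S : seq (stop sigma)} :
  is_line loc -> MAIN_state loc Cap t s D S -> serving_state loc Cap t s D S.
Proof.
move=> hline; elim=> {t s D S}.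
- split=> //; first by move=> p; rewrite inE.
  move=> k; rewrite (_ : on_board _ = set0) ?cards0 //.
- move=> t s D S p _ [hS [hs ht] hD hnD hC] W0 pD _; split=> //; split=> //.
  (* Waiting never turns the clock back: an unserved passenger released before [t] would already be
     waiting. *)
  apply: le_trans ht _; rewrite leNgt; apply/negP => lt_t.
  by move/setP/(_ p): W0; rewrite !inE pD (ltW lt_t).
- move=> t s D S A f _ IH W0 [/subsetP AW AC _ /(_ W0)/set0Pn[p pA]] fE.
  have le_f q : q \in A -> (pdst q <= f)%N.
    by move=> qA; rewrite fE; exact: (leq_bigmax_cond (F := @pdst R n sigma)).
  have W q : q \in A -> [/\ prel q <= t, q \notin D, (s <= porg q)%N &
                          (porg q <= pdst q)%N].
    by move=> /AW; rewrite !inE => /andP[/andP[-> ->]] /andP[-> ->].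
  have sf : (s <= f)%N.
    by have [_ _ h1 h2] := W p pA; rewrite (leq_trans h1) // (leq_trans h2) ?le_f.
  have := serving_state_sweep (direction_upward hline) IH
    (path_stations_up s f) (uniq_stations_up s f) _ (last_stations_up s f sf) _ AC.
  rewrite distxx addr0; apply.
  + have : s \in stations_up s f by rewrite mem_stations_up leqnn.
    by case: (stations_up s f).
  + by rewrite disjoint_subset; apply/subsetP => q /W[].
  + move=> q qA; have [h1 h2 h3 h4] := W q qA.
    rewrite !mem_stations_up /upward h1 h4 h3 le_f // (leq_trans h3 h4).
    by rewrite (leq_trans h4) ?le_f.
- move=> t s D S A m _ IH W0 _ [/subsetP AW AC _ _] mE.
  have W q : q \in A -> [/\ prel q <= t, q \notin D & (pdst q < porg q)%N].
    by move=> /AW; rewrite !inE => /andP[/andP[-> ->]] ->.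
  have le_m q : q \in A -> (porg q <= m)%N.
    move=> qA; rewrite mE leq_max; apply/orP; right.
    exact: (leq_bigmax_cond (F := @porg R n sigma)).
  apply: (serving_state_sweep (direction_downward hline) IH
    (path_stations_down m) _ _ (last_stations_down m) _ AC).
  + by rewrite stations_downE rev_uniq uniq_stations_up.
  + have : m \in stations_down m.
      by rewrite stations_downE mem_rev mem_stations_up /=.
    by case: (stations_down m).
  + by rewrite disjoint_subset; apply/subsetP => q /W[].
  + move=> q qA; have [h1 _ h2] := W q qA.
    rewrite stations_downE !mem_rev !mem_stations_up /downward h1 (ltnW h2) /=.
    by rewrite le_m // (leq_trans (ltnW h2)) ?le_m.
Qed.

Lemma MAIN_feasible {R : realType} {n : nat} {loc : 'I_n.+1 -> R} {Cap : nat}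
    {sigma : seq (request R n)} {S : seq (stop sigma)} :
  is_line loc -> MAIN loc Cap S -> feasible loc Cap S.
Proof.
move=> hline [t [s [S' [/(MAIN_serving_state hline) st ->]]]].
(* The return to [v_0] is a sweep that visits only [v_0] and carries nobody. *)
have := serving_state_sweep (A := set0) (u := ord0) (w := [:: ord0])
  (direction_upward hline) st isT isT isT erefl.
rewrite /sweep /= distxx addr0 !setIdE !set0I cats1.
case=> [||p|hS [hs _] hT _ hC].
- by rewrite disjoint_subset; apply/subsetP => q; rewrite inE.
- by rewrite cards0.
- by rewrite inE.
- by split=> // p; apply: hT; rewrite !inE.
Qed.

(** * Termination of [MAIN] *)

Lemma selection_exists {Cap : nat} {T : finType} (W : {set T}) :
  (0 < Cap)%N -> exists A, selection Cap W A.
Proof.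
move=> Cap0; have [WC|CW] := leqP #|W| Cap; first by exists W.
have [W0|[x xW]] := set_0Vmem W; first by rewrite W0 cards0 in CW.
exists [set x]; split; rewrite ?sub1set ?cards1 //; last first.
  by move=> _; apply/set0Pn; exists x; rewrite inE.
by move=> /(leq_trans CW); rewrite ltnn.
Qed.

Lemma MAIN_up_step {R : realType} {n : nat} {loc : 'I_n.+1 -> R} {Cap : nat}
    {sigma : seq (request R n)} {t s D} {S : seq (stop sigma)} :
  (0 < Cap)%N -> MAIN_state loc Cap t s D S -> waiting_up t s D != set0 ->
  exists t' s' D' S', MAIN_state loc Cap t' s' D' S' /\ D \proper D'.
Proof.
move=> Cap0 st W0; have [A selA] := selection_exists (waiting_up t s D) Cap0.
have [/subsetP AW _ _ /(_ W0)/set0Pn[p pA]] := selA.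
have fn : (\max_(p in A) pdst p < n.+1)%N.
  by rewrite ltnS; apply/bigmax_leqP => q _; rewrite -ltnS.
do 4!eexists; split; first exact: (MAIN_up st W0 selA (f := Ordinal fn)).
rewrite properE subsetUl; apply/subsetPn; exists p.
  by rewrite inE pA orbT.
by move: (AW p pA); rewrite !inE => /andP[/andP[]].
Qed.

(** A single decision may serve nobody: a wait, or a down move without passengers. In both cases the
    next decisions do serve someone. *)
Lemma MAIN_progress {R : realType} {n : nat} {loc : 'I_n.+1 -> R} {Cap : nat}
    {sigma : seq (request R n)} {t s D} {S : seq (stop sigma)} :
  (0 < Cap)%N -> MAIN_state loc Cap t s D S -> D != [set: passenger sigma] ->
  exists t' s' D' S', MAIN_state loc Cap t' s' D' S' /\ D \proper D'.
Proof.
move=> Cap0 st DT.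
(* If nobody is waiting, the server waits for the earliest release among the unserved, after which
   somebody is. *)
wlog [p] : t st / exists p, p \in waiting t D.
  move=> IH; case: (set_0Vmem (waiting t D)) => [W0|[p pW]]; last first.
    by apply: IH st _; exists p.
  have /subsetPn[q0 _ q0D] : ~~ ([set: passenger sigma] \subset D).
    by rewrite subTset.
  case: (@arg_minP _ _ _ q0 [pred q | q \notin D] (@prel R n sigma) q0D) => p pD min_p.
  apply: IH (MAIN_wait st W0 pD min_p) _; exists p.
  by rewrite !inE lexx.
rewrite inE => /andP[pt pD].
have [U0|U0] := eqVneq (waiting_up t s D) set0; last exact: MAIN_up_step st U0.
have W0 : waiting t D != set0 by apply/set0Pn; exists p; rewrite inE pt pD.
have [A selA] := selection_exists (waiting_down t D) Cap0.
have mn : (maxn s (\max_(p in A) porg p) < n.+1)%N.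
  rewrite gtn_max ltn_ord ltnS /=; apply/bigmax_leqP => q _; by rewrite -ltnS.
have st' := MAIN_down st W0 U0 selA (m := Ordinal mn) erefl.
have [/subsetP AW _ _ A0] := selA.
have [D0|/A0/set0Pn[q qA]] := eqVneq (waiting_down t D) set0; last first.
  do 4!eexists; split; first exact: st'.
  rewrite properE subsetUl; apply/subsetPn; exists q.
    by rewrite inE qA orbT.
  by move: (AW q qA); rewrite !inE => /andP[/andP[]].
(* Nobody goes down, so the down move only brings the server to [v_0]. From there every waiting ride
   that does not go down can be taken by an up move, that of [p] in particular. *)
have DA : D :|: A = D.
  by apply/setUidPl/subsetP => q /AW; rewrite D0 inE.
rewrite DA in st'.
apply: MAIN_up_step st' _ => //; apply/set0Pn; exists p.
rewrite !inE pD -addrA (le_trans pt) ?lerDl ?addr_ge0 ?dist_ge0 //=.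
move/setP/(_ p): D0; rewrite !inE pt pD /= => /negbT; by rewrite -leqNgt.
Qed.

(** By induction on the number of unserved passengers, which each application of [MAIN_progress]
    decreases. *)
Lemma MAIN_exists {R : realType} {n : nat} (loc : 'I_n.+1 -> R) {Cap : nat}
    (sigma : seq (request R n)) :
  (0 < Cap)%N -> exists S : seq (stop sigma), MAIN loc Cap S.
Proof.
move=> Cap0.
suff [t [s [S st]]] : exists t s S,
    MAIN_state loc Cap t s [set: passenger sigma] S.
  by exists (rcons S (Stop ord0 (t + dist loc s ord0) set0 set0)), t, s, S.
suff run k (D : {set passenger sigma}) t s S :
    (#|~: D| < k)%N -> MAIN_state loc Cap t s D S ->
    exists t s S, MAIN_state loc Cap t s [set: passenger sigma] S.
  exact: run (ltnSn _) (MAIN_start loc Cap sigma).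
elim: k D t s S => [|k IH] D t s S le_k st; first by rewrite ltn0 in le_k.
have [DT|DT] := eqVneq D [set: passenger sigma].
  by exists t, s, S; rewrite -DT.
have [t' [s' [D' [S' [st' DD']]]]] := MAIN_progress Cap0 st DT.
apply: IH st'; rewrite -ltnS; apply: leq_trans le_k.
by rewrite ltnS; apply: proper_card; rewrite properC.
Qed.

(** * A lower bound on the length of feasible tours *)

Lemma has_take_nth {T : Type} {d : T} {S : seq T} {a : pred T} {i : nat} k :
  (i < size S)%N -> (forall l, (l < size S)%N -> a (nth d S l) = (l == i)) ->
  has a (take k S) = (i < k)%N.
Proof.
move=> iS ha; apply/(has_nthP d)/idP => [[l]|ik].
  rewrite size_take_min leq_min => /andP[lk lS].
  by rewrite nth_take // ha // => /eqP <-.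
by exists i; rewrite ?size_take_min ?leq_min ?ik // nth_take // ha.
Qed.

(** A passenger's displacement is the sum of the vehicle's displacements over the legs spent on
    board. Prepending the depot makes leg [k] end at stop [k] of [S], so the load on it is fixed by
    the first [k] stops. Here [g] stands for [loc] or its opposite. *)
Lemma transported_displacement {R : realType} {n : nat}
    {sigma : seq (request R n)} {S : seq (stop sigma)} {p}
    (g : 'I_n.+1 -> R) :
  let x k := g (station (nth (depot sigma) (depot sigma :: S) k)) in
  transported S p ->
  g (pdst p) - g (porg p) =
  \sum_(0 <= k < size S) (x k.+1 - x k) *+ (p \in on_board (take k S)).
Proof.
move=> x [i [j [/andP[ij jS] hb ha [so _] sd]]].
have iS := leq_ltn_trans ij jS.
(* A passenger boarding at stop [i] and alighting at stop [j] is on board exactly on the legs [k]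
   with [i < k <= j]; the displacements over these legs telescope. *)
rewrite -so -sd -/(x i.+1) -/(x j.+1) -telescope_sumr //.
rewrite (big_nat_widenl _ 0) // (big_nat_widen _ _ (size S)) // big_mkcond.
apply: eq_bigr => k _; rewrite inE.
rewrite (has_take_nth _ iS hb) (has_take_nth _ jS ha) -leqNgt ltnS /=.
by case: (i < k)%N; case: (k <= j)%N.
Qed.

(* Every leg carries at most [Cap] passengers, and on a closed tour the
   progress made in either direction is half of the length. *)
Lemma feasible_tour_ge {R : realType} {n : nat} {loc : 'I_n.+1 -> R}
    {Cap : nat} {sigma : seq (request R n)} {S : seq (stop sigma)}
    {g : 'I_n.+1 -> R} (P : {set passenger sigma}) :
  (forall u v, `|g u - g v| = dist loc u v) -> feasible loc Cap S ->
  2 * \sum_(p in P) (g (pdst p) - g (porg p)) <=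
  Cap%:R * tour_length loc S.
Proof.
move=> gE [_ lastS tr cap].
pose x k := g (station (nth (depot sigma) (depot sigma :: S) k)).
(* The number of passengers of [P] on board during leg [k]. *)
pose c k := (\sum_(p in P) (p \in on_board (take k S)))%N.
have -> : \sum_(p in P) (g (pdst p) - g (porg p)) =
    \sum_(0 <= k < size S) (x k.+1 - x k) *+ c k.
  under eq_bigr => p _ do rewrite (transported_displacement g (tr p)) -/x.
  by rewrite exchange_big; apply: eq_bigr => k _; rewrite sumrMnr.
(* On a closed tour the signed displacements cancel. Adding them to the length turns each term into
   twice the positive part of the displacement. *)
have -> : tour_length loc S =
    \sum_(0 <= k < size S) (`|x k.+1 - x k| + (x k.+1 - x k)).
  rewrite big_split /= telescope_sumr // /x nth_last /= lastS subrr addr0.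
  rewrite /tour_length (route_length_sum _ ord0) size_map.
  apply: eq_big_nat => k /andP[_ kS].
  rewrite gE dist_sym -[_ :: _]/(map _ (depot sigma :: S)).
  by rewrite !(nth_map (depot sigma)) //= ltnW.
rewrite !mulr_sumr; apply: ler_sum => k _.
have ck : (c k)%:R <= Cap%:R :> R.
  rewrite ler_nat (leq_trans _ (cap k)) // /c -big_mkcondr /= sum1_card.
  by apply/subset_leq_card/subsetP => p; rewrite unfold_in => /andP[].
have c0 : 0 <= (c k)%:R :> R by rewrite ler0n.
rewrite -mulr_natr; set d := x k.+1 - x k.
have dN : 0 <= `|d| + d by have := ler_norm (- d); rewrite normrN; lra.
(* With load [c] at most [Cap], each leg satisfies [2 d c <= (|d| + d) c <= Cap (|d| + d)]. *)
have := ler_wpM2l dN ck; have := ler_wpM2r c0 (ler_norm d); lra.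
Qed.

Lemma feasible_tour_ge_up {R : realType} {n : nat} {loc : 'I_n.+1 -> R}
    {Cap : nat} {sigma : seq (request R n)} {S : seq (stop sigma)}
    (P : {set passenger sigma}) :
  is_line loc -> feasible loc Cap S ->
  (forall p, p \in P -> (porg p <= pdst p)%N) ->
  2 * \sum_(p in P) dist loc (porg p) (pdst p) <= Cap%:R * tour_length loc S.
Proof.
move=> hline fS hP; apply: le_trans (feasible_tour_ge (g := loc) P _ fS) => //.
rewrite ler_pM2l // ler_sum // => p /hP pup.
by rewrite (dist_line hline pup).
Qed.

Lemma feasible_tour_ge_down {R : realType} {n : nat} {loc : 'I_n.+1 -> R}
    {Cap : nat} {sigma : seq (request R n)} {S : seq (stop sigma)}
    (P : {set passenger sigma}) :
  is_line loc -> feasible loc Cap S ->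
  (forall p, p \in P -> (pdst p <= porg p)%N) ->
  2 * \sum_(p in P) dist loc (porg p) (pdst p) <= Cap%:R * tour_length loc S.
Proof.
move=> hline fS hP.
(* Negating the coordinates turns rides down into rides up. *)
apply: le_trans (feasible_tour_ge (g := fun v => - loc v) P _ fS) => //.
  rewrite ler_pM2l // ler_sum // => p /hP pdown.
  by rewrite dist_sym (dist_line hline pdown) opprK addrC.
by move=> u v; rewrite opprK addrC -distrC.
Qed.

(** * An upper bound on the length of the tours of [MAIN] *)

Lemma tour_length_sweep {R : realType} {n : nat} {loc : 'I_n.+1 -> R} {e}
    {Cap : nat} {sigma : seq (request R n)} {t s D} {S : seq (stop sigma)}
    (A : {set passenger sigma}) t' {u f w} :
  direction loc e -> serving_state loc Cap t s D S ->
  path e u w -> last u w = f ->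
  tour_length loc (S ++ sweep loc A t' u w) <=
  tour_length loc S + dist loc s u + dist loc u f.
Proof.
move=> dir [_ [hs _] _ _ _] uw lw.
rewrite /tour_length map_cat route_length_cat -addrA lerD2l -map_comp map_id.
rewrite (last_map _ _ (depot sigma)) hs -lw -(route_length_monotone _ _ dir uw).
exact: route_length_detour.
Qed.

(** The distance back to [v_0] acts as a potential: an up move pays at once for its return, so a
    later down move starting from there costs nothing more unless it first goes beyond [s]. *)
Lemma MAIN_state_tour_le {R : realType} {n : nat} {loc : 'I_n.+1 -> R}
    {Cap : nat} {sigma : seq (request R n)} {t s D} {S : seq (stop sigma)} :
  is_line loc -> lunch sigma -> MAIN_state loc Cap t s D S ->
  tour_length loc S + dist loc s ord0 <=
  2 * \sum_(p in D) dist loc (porg p) (pdst p).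
Proof.
move=> hline hl.
have lunchE (p : passenger sigma) : porg p = ord0 \/ pdst p = ord0.
  exact: hl (tag p).
have sumU (E A : {set passenger sigma}) : [disjoint A & E] ->
    \sum_(p in E :|: A) dist loc (porg p) (pdst p) =
    \sum_(p in E) dist loc (porg p) (pdst p) +
    \sum_(p in A) dist loc (porg p) (pdst p).
  move=> AE; rewrite -bigU /=; last by rewrite disjoint_sym.
  by apply: eq_bigl => p; rewrite !inE.
have sum_ge (A : {set passenger sigma}) p : p \in A ->
    dist loc (porg p) (pdst p) <= \sum_(p in A) dist loc (porg p) (pdst p).
  move=> pA; rewrite (bigD1 p) //= lerDl sumr_ge0 // => q _; exact: dist_ge0.
elim=> {t s D S}.
- by rewrite big_set0 distxx addr0 mulr0.
- by [].
- move=> t s D S A f st IH W0 [/subsetP AW _ _ /(_ W0) A0] fE.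
  have AD : [disjoint A & D].
    rewrite disjoint_subset; apply/subsetP => q /AW.
    by rewrite !inE => /andP[/andP[]].
  have [p pA fp] : {p | p \in A & (\max_(p in A) pdst p)%N = pdst p :> nat}.
    by apply: eq_bigmax_cond; rewrite card_gt0.
  (* The move is charged to a passenger [p] with the furthest destination. In the lunch scenario a
     ride up starts at [v_0], hence so does the move. *)
  have {fE fp} -> : f = pdst p by apply/val_inj; rewrite /= fE fp.
  have := AW p pA; rewrite !inE => /andP[_ /andP[sp pp]].
  have p0 : porg p = ord0.
    case: (lunchE p) => // d0; apply/val_inj/eqP.
    by rewrite -leqn0; rewrite d0 in pp.
  have s0 : s = ord0.
    by apply/val_inj/eqP; rewrite -leqn0; rewrite p0 in sp.
  have := tour_length_sweep A t (direction_upward hline)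
    (MAIN_serving_state hline st) (path_stations_up s (pdst p))
    (last_stations_up _ _ (leq_trans sp pp)).
  have := sum_ge A p pA; rewrite (sumU _ _ AD) p0 s0 distxx.
  move: IH; rewrite s0 distxx (dist_sym _ (pdst p)).
  move: (tour_length _ (S ++ _)) => *; lra.
- move=> t s D S A m st IH W0 _ [/subsetP AW _ _ _] mE.
  have AD : [disjoint A & D].
    rewrite disjoint_subset; apply/subsetP => q /AW.
    by rewrite !inE => /andP[/andP[]].
  rewrite distxx addr0 (sumU _ _ AD).
  have := tour_length_sweep A (t + dist loc s m) (direction_downward hline)
    (MAIN_serving_state hline st) (path_stations_down m)
    (last_stations_down m).
  move: (tour_length _ (S ++ _)) => T le_T.
  have A_ge0 : 0 <= \sum_(p in A) dist loc (porg p) (pdst p).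
    by apply: sumr_ge0 => q _; exact: dist_ge0.
  (* Without a detour beyond [s], the move is the return already accounted for in the potential. *)
  have [ms|sm] := leqP m s.
    have ms' : m = s by apply/val_inj/anti_leq; rewrite /= ms mE leq_maxl.
    by move: le_T; rewrite ms' distxx; lra.
  (* Otherwise [m] is the origin of some [p] in [A] whose ride goes down to [v_0], and the extra
     travel is at most twice the length of that ride. *)
  have Am : (\max_(p in A) porg p)%N = m by move: sm; rewrite mE; lia.
  have [p pA pm] : {p | p \in A & (\max_(p in A) porg p)%N = porg p :> nat}.
    apply: eq_bigmax_cond; rewrite card_gt0; apply/negP => /eqP A0.
    by move: Am sm; rewrite A0 big_set0 => <-.
  have {Am pm} pm : porg p = m by apply/val_inj; rewrite /= -Am pm.
  have := AW p pA; rewrite !inE => /andP[_ pp].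
  have p0 : pdst p = ord0 by case: (lunchE p) => // o0; rewrite o0 in pp.
  have := sum_ge A p pA; rewrite p0 pm.
  have := dist_triangle loc ord0 s m; rewrite (dist_sym _ ord0 m); lra.
Qed.

Lemma MAIN_tour_le {R : realType} {n : nat} {loc : 'I_n.+1 -> R}
    {Cap : nat} {sigma : seq (request R n)} {S : seq (stop sigma)} :
  is_line loc -> lunch sigma -> MAIN loc Cap S ->
  tour_length loc S <=
  2 * \sum_(p : passenger sigma) dist loc (porg p) (pdst p).
Proof.
move=> hline hl [t [s [S' [st ->]]]].
have [_ [hs _] _ _ _] := MAIN_serving_state hline st.
have := MAIN_state_tour_le hline hl st.
rewrite /tour_length map_rcons -cats1 route_length_cat /= addr0.
rewrite (last_map _ _ (depot sigma)) hs => /le_trans; apply.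
by rewrite (eq_bigl xpredT) // => p; rewrite inE.
Qed.

(** * The competitive ratios *)

(** Twice the total length of the rides separates [MAIN] from the optimum: it bounds the tour of
    [MAIN] from above and [c] times every feasible tour from below, hence [c] times their
    infimum. *)
Lemma MAIN_competitive {R : realType} {n : nat} {loc : 'I_n.+1 -> R}
    {Cap : nat} {scenario : seq (request R n) -> Prop} {c : R} :
  is_line loc -> (0 < Cap)%N -> 0 < c ->
  (forall sigma, scenario sigma -> lunch sigma) ->
  (forall sigma (S : seq (stop sigma)), scenario sigma -> feasible loc Cap S ->
     2 * \sum_(p : passenger sigma) dist loc (porg p) (pdst p) <=
     c * tour_length loc S) ->
  competitive loc Cap scenario (MAIN loc Cap) c.
Proof.
move=> hline hCap c0 hlunch hlb sigma _ hs; split; first exact: MAIN_exists.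
move=> S hS; have fS := MAIN_feasible hline hS; split=> //.
apply: le_trans (MAIN_tour_le hline (hlunch _ hs) hS) _.
rewrite -ler_pdivrMl //; apply: lb_le_inf.
  (* The infimum is over a nonempty set, as the schedule of [MAIN] is itself feasible. *)
  by exists (tour_length loc S), S.
by move=> _ [S' [fS' ->]]; rewrite ler_pdivrMl // hlb.
Qed.

Theorem theorem6 (R : realType) (n : nat) (loc : 'I_n.+1 -> R) (Cap : nat)
    (hline : is_line loc) (hCap : (0 < Cap)%N) :
  competitive loc Cap (@lunch R n) (MAIN loc Cap) (2 * Cap%:R)
  /\ (competitive loc Cap (@morning R n) (MAIN loc Cap) Cap%:R
      /\ competitive loc Cap (@evening R n) (MAIN loc Cap) Cap%:R).
Proof.
have Cap0 : 0 < Cap%:R :> R by rewrite ltr0n.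
have sumT (sigma : seq (request R n)) :
    \sum_(p : passenger sigma) dist loc (porg p) (pdst p) =
    \sum_(p in [set: passenger sigma]) dist loc (porg p) (pdst p).
  by apply: eq_bigl => p; rewrite inE.
split; [|split]; apply: MAIN_competitive => //.
- by rewrite mulr_gt0.
(* Rides up and rides down are bounded separately, each by [Cap] times the tour length; this is
   where the factor 2 arises. Rides of length zero are put with those going up. *)
- move=> sigma S _ fS; pose U := [set p : passenger sigma | (porg p <= pdst p)%N].
  have up : forall p, p \in U -> (porg p <= pdst p)%N by move=> p; rewrite inE.
  have down : forall p, p \in ~: U -> (pdst p <= porg p)%N.
    by move=> p; rewrite !inE -ltnNge => /ltnW.
  have := feasible_tour_ge_up U hline fS up.
  have := feasible_tour_ge_down (~: U) hline fS down.
  suff -> : \sum_(p : passenger sigma) dist loc (porg p) (pdst p) =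
      \sum_(p in U) dist loc (porg p) (pdst p) +
      \sum_(p in ~: U) dist loc (porg p) (pdst p) by lra.
  rewrite (bigID (mem U)) /=; congr (_ + _).
  by apply: eq_bigl => p; rewrite in_setC.
- by move=> sigma hm j; left; exact: hm.
- move=> sigma S hm fS; rewrite sumT.
  by apply: feasible_tour_ge_up => // p _; rewrite /porg /preq hm.
- by move=> sigma he j; right; exact: he.
- move=> sigma S he fS; rewrite sumT.
  by apply: feasible_tour_ge_down => // p _; rewrite /pdst /preq he.
Qed.
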